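(* The space $\Gamma^{\mathbb{R}}_{(N)}$ is homeomorphic with $\mathscr{C}_{\mathrm{inext}}^N$, i.e. with the $N$-th Cartesian power of the space of all inextendible unparametrised causal curves in $\mathcal{M}$.
   Context: Setting. $\mathcal{M}$ is a globally hyperbolic spacetime (a connected, time-oriented smooth Lorentzian manifold without causal loops, such that all sets $J^+(p)\cap J^-(q)$ are compact), with causal precedence relation $\preceq$ ($p\preceq q$ iff $p=q$ or there is a piecewise smooth future-directed causal curve from $p$ to $q$; $p\prec q$ iff $p\preceq q$ and $p\neq q$). A continuous curve $\gamma:I\to\mathcal{M}$ on an interval is (future-directed) causal if $s<t$ implies $\gamma(s)\prec\gamma(t)$. $\mathcal{T}:\mathcal{M}\to\mathbb{R}$ is a fixed Cauchy temporal function (smooth, with past-directed timelike gradient, all level sets being Cauchy hypersurfaces), $\Sigma:=\mathcal{T}^{-1}(0)$, and $\Phi:\mathcal{M}\to\mathbb{R}\times\Sigma$ is the associated Geroch–Bernal–Sánchez splitting: a diffeomorphism whose first component is $\mathcal{T}$, for which the metric is $g=-\alpha\,d\mathcal{T}\otimes d\mathcal{T}+\bar g$ with $\alpha>0$ smooth and $\bar g$ a symmetric 2-covariant tensor field restricting to a Riemannian metric on each level set of $\mathcal{T}$ and with radical spanned at each point by $\nabla\mathcal{T}$. $N$-particle configuration spacetime. $N\ge1$ is an integer, $\mathcal{M}_{(N)}:=\mathbb{R}\times\Sigma^N$ (product manifold), $\pi^0$ is the projection onto the $\mathbb{R}$ factor, $\iota^j(t,x_1,\dots,x_N):=\Phi^{-1}(t,x_j)$,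 $\boldsymbol{p}^j:=\iota^j(\boldsymbol{p})$. For $\boldsymbol{p},\boldsymbol{q}\in\mathcal{M}_{(N)}$: $\boldsymbol{p}\preceq\boldsymbol{q}$ iff $\boldsymbol{p}^j\preceq\boldsymbol{q}^j$ in $\mathcal{M}$ for all $j$; $\boldsymbol{p}\prec\boldsymbol{q}$ iff $\boldsymbol{p}\preceq\boldsymbol{q}$ and $\boldsymbol{p}\ne\boldsymbol{q}$. A continuous curve $\boldsymbol{\gamma}:I\to\mathcal{M}_{(N)}$ is causal if $s<t$ implies $\boldsymbol{\gamma}(s)\prec\boldsymbol{\gamma}(t)$. Spaces of curves. $\Gamma^{\mathbb{R}}_{(N)}$ is the space of all continuous causal curves $\boldsymbol{\gamma}:\mathbb{R}\to\mathcal{M}_{(N)}$ with $\pi^0\circ\boldsymbol{\gamma}=\mathrm{id}_{\mathbb{R}}$, with the compact-open topology. $A^{\mathbb{R}}_{\mathcal{T}}$ is the space of continuous causal curves $\gamma:\mathbb{R}\to\mathcal{M}$ with $\mathcal{T}\circ\gamma=\mathrm{id}_{\mathbb{R}}$, with the compact-open topology. $\mathscr{C}_{\mathrm{inext}}$ is the set of images of inextendible continuous causal curves in $\mathcal{M}$ (inextendible unparametrised causal curves). It is known that $\gamma\mapsto\gamma(\mathbb{R})$ is a bijection $A^{\mathbb{R}}_{\mathcal{T}}\to\mathscr{C}_{\mathrm{inext}}$; $\mathscr{C}_{\mathrm{inext}}$ carries the topology transported from $A^{\mathbb{R}}_{\mathcal{T}}$ by this bijection (known to be independent of the choice of the Cauchy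 temporal function $\mathcal{T}$), and $\mathscr{C}_{\mathrm{inext}}^N$ the product topology. *)

(* Defs.v *)
From HB Require Import structures.
From mathcomp Require Import all_boot all_order all_algebra.
From mathcomp Require Import all_classical all_reals all_analysis.
From mathcomp Require Import lra.

Set Implicit Arguments.
Unset Strict Implicit.
Unset Printing Implicit Defensive.

Import Order.TTheory GRing.Theory Num.Theory.
Import numFieldNormedType.Exports.

Local Open Scope classical_set_scope.
Local Open Scope ring_scope.

Definition homeomorphic (X Y : topologicalType) : Prop :=
  exists (f : X -> Y) (g : Y -> X),
    [/\ continuous f, continuous g, cancel f g & cancel g f].

Section Smooth.
Context {R : realType} {V W : normedModType R}.

Fixpoint iter_derive (vs : seq V) (f : V -> W) : V -> W :=
  if vs is v :: vs' then fun x => 'D_v (iter_derive vs' f) x else f.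

(* f is C^oo on a whole neighbourhood of x (V finite-dimensional). *)
Definition smooth_at (f : V -> W) (x : V) : Prop :=
  \forall y \near x, forall vs : seq V,
    {for y, continuous (iter_derive vs f)} /\
    forall v, derivable (iter_derive vs f) y v.

End Smooth.

(* [cmap] and [cinv] are total functions, meaningful only on [cdom] and on
   [cmap @` cdom] respectively. *)
Record chart (R : realType) (n : nat) (M : topologicalType) := Chart {
  cdom : set M;
  cmap :> M -> 'rV[R]_n;
  cinv : 'rV[R]_n -> M;
  cdom_open : open cdom;
  cimage_open : open (cmap @` cdom);
  cmapK : {in cdom, cancel cmap cinv};
  cmap_continuous : {in cdom, continuous cmap};
  cinv_continuous : {in cmap @` cdom, continuous cinv} }.

Definition transition (R : realType) (n : nat) (M : topologicalType)
    (c c' : chart R n M) : 'rV[R]_n -> 'rV[R]_n := c' \o cinv c.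

Record manifold (R : realType) (n : nat) := Manifold {
  points :> topologicalType;
  points_hausdorff : hausdorff_space points;
  points_second_countable : @second_countable points;
  cindex : Type;
  atlas : cindex -> chart R n points;
  atlas_cover : forall p, exists i, cdom (atlas i) p;
  atlas_smooth : forall i j p, cdom (atlas i) p -> cdom (atlas j) p ->
    smooth_at (transition (atlas i) (atlas j)) (atlas i p) }.

Arguments atlas {R n} m i.

Section Manifolds.
Context {R : realType} {n : nat} (M : manifold R n).
Local Notation A := (atlas M).

Definition smooth_fun_at (f : M -> R) (p : M) : Prop :=
  forall i, cdom (A i) p -> smooth_at (f \o cinv (A i)) (A i p).

Definition smooth_map_at (f : M -> M) (p : M) : Prop :=
  {for p, continuous f} /\
  forall i j, cdom (A i) p -> cdom (A j) (f p) ->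
    smooth_at (A j \o f \o cinv (A i)) (A i p).

Definition smooth_prod_at (f : R * M -> M) (z : R * M) : Prop :=
  {for z, continuous f} /\
  forall i j, cdom (A i) z.2 -> cdom (A j) (f z) ->
    smooth_at (fun y : R^o * 'rV[R]_n => A j (f (y.1, cinv (A i) y.2)))
              (z.1, A i z.2).

Definition smooth_curve_at (c : R -> M) (t : R) : Prop :=
  {for t, continuous c} /\
  forall i, cdom (A i) (c t) -> smooth_at (A i \o c : R^o -> 'rV[R]_n) t.

(* A tangent vector at p is given by its components in a chart around p;
   tensor fields are given by their components in every chart, subject to the
   transformation law and meaningful only on the chart domains. *)
Definition velocity (c : R -> M) (i : cindex M) (t : R) : 'rV[R]_n :=
  derive1 (A i \o c) t.

Definition differential (f : M -> R) (i : cindex M) (p : M)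
    (v : 'rV[R]_n) : R :=
  'D_v (f \o cinv (A i)) (A i p).

Definition form (G : 'M[R]_n) (v w : 'rV[R]_n) : R := (v *m G *m w^T) 0 0.

Definition vector_field (X : cindex M -> M -> 'rV[R]_n) : Prop :=
  (forall i p, cdom (A i) p -> smooth_at (X i \o cinv (A i)) (A i p)) /\
  (forall i j p, cdom (A i) p -> cdom (A j) p ->
     X j p = 'D_(X i p) (transition (A i) (A j)) (A i p)).

Definition symmetric_tensor_field (G : cindex M -> M -> 'M[R]_n) : Prop :=
  [/\ forall i p, cdom (A i) p -> smooth_at (G i \o cinv (A i)) (A i p),
      forall i p, cdom (A i) p -> (G i p)^T = G i p
    & forall i j p, cdom (A i) p -> cdom (A j) p -> forall v w,
        let D u := 'D_u (transition (A i) (A j)) (A i p) in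
        form (G i p) v w = form (G j p) (D v) (D w)].

End Manifolds.

Definition minkowski_mx (R : realType) (n : nat) : 'M[R]_n.+1 :=
  diag_mx (\row_(i < n.+1) if i == ord0 then -1 else 1).

Definition lorentzian (R : realType) (n : nat) (G : 'M[R]_n.+1) : Prop :=
  exists2 P : 'M[R]_n.+1, P \in unitmx & P *m G *m P^T = minkowski_mx R n.

(* The time orientation is given by a smooth timelike vector field, declared
   to be future-directed. *)
Record spacetime (R : realType) (n : nat) := Spacetime {
  events :> manifold R n.+1;
  events_connected : connected [set: events];
  metric : cindex events -> events -> 'M[R]_n.+1;
  metric_tensor : symmetric_tensor_field metric;
  metric_lorentzian : forall i p, cdom (atlas events i) p ->
    lorentzian (metric i p);
  torient : cindex events -> events -> 'rV[R]_n.+1;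
  torient_field : vector_field torient;
  torient_timelike : forall i p, cdom (atlas events i) p ->
    form (metric i p) (torient i p) (torient i p) < 0 }.

Arguments metric {R n} s i p.
Arguments torient {R n} s i p.

Section Causality.
Context {R : realType} {n : nat} (M : spacetime R n).
Local Notation A := (atlas M).

Definition future_causal (i : cindex M) (p : M) (v : 'rV[R]_n.+1) : Prop :=
  [/\ v != 0, form (metric M i p) v v <= 0
    & form (metric M i p) (torient M i p) v < 0].

Definition past_timelike (i : cindex M) (p : M) (v : 'rV[R]_n.+1) : Prop :=
  form (metric M i p) v v < 0 /\ 0 < form (metric M i p) (torient M i p) v.

Definition is_gradient (f : M -> R) (i : cindex M) (p : M)
    (u : 'rV[R]_n.+1) : Prop :=
  forall v, form (metric M i p) u v = differential f i p v.

Definition smooth_causal_at (c : R -> M) (t : R) : Prop :=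
  smooth_curve_at c t /\
  forall i, cdom (A i) (c t) -> future_causal i (c t) (velocity c i t).

(* On each closed piece of the partition g agrees with a curve c that is smooth
   near that piece, so that one-sided velocities are future-directed causal at
   the break points too. *)
Definition pw_smooth_causal (g : R -> M) (a b : R) : Prop :=
  [/\ a < b, {within `[a, b], continuous g}
    & exists2 s : seq R, itv_partition a b s &
        forall k, (k < size s)%N ->
          let J := `[nth b (a :: s) k, nth b s k]%classic in
          exists c : R -> M, forall t, J t -> g t = c t /\ smooth_causal_at c t].

Definition prec (p q : M) : Prop :=
  p = q \/ exists (g : R -> M) (a b : R),
    [/\ pw_smooth_causal g a b, g a = p & g b = q].

Definition sprec (p q : M) : Prop := prec p q /\ p <> q.

Definition globally_hyperbolic : Prop :=
  (forall g a b, pw_smooth_causal g a b -> g a <> g b) /\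
  (forall p q, compact [set r | prec p r /\ prec r q]).

End Causality.

Definition causal_curve (R : realType) (X : topologicalType)
    (lt : X -> X -> Prop) (I : set R) (g : R -> X) : Prop :=
  {within I, continuous g} /\
  forall s t, I s -> I t -> s < t -> lt (g s) (g t).

Section Inextendible.
Context {R : realType} {n : nat} (M : spacetime R n).

Definition future_endpoint (I : set R) (g : R -> M) (p : M) : Prop :=
  forall U, nbhs p U ->
    exists2 t0, I t0 & forall t, I t -> t0 <= t -> U (g t).

Definition past_endpoint (I : set R) (g : R -> M) (p : M) : Prop :=
  forall U, nbhs p U ->
    exists2 t0, I t0 & forall t, I t -> t <= t0 -> U (g t).

Definition inextendible (I : set R) (g : R -> M) : Prop :=
  [/\ is_interval I, I !=set0, causal_curve (@sprec _ _ M) I g,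
      ~ (exists p, future_endpoint I g p)
    & ~ (exists p, past_endpoint I g p)].

Definition Cinext : set (set M) :=
  [set L | exists I g, inextendible I g /\ g @` I = L].

Definition cauchy_hypersurface (S : set M) : Prop :=
  forall I g, inextendible I g -> exists! t, I t /\ S (g t).

End Inextendible.

Arguments Cinext {R n} M.

Record cauchy_temporal (R : realType) (n : nat) (M : spacetime R n) :=
  CauchyTemporal {
  ctfun :> M -> R;
  ctfun_smooth : forall p, smooth_fun_at ctfun p;
  ctfun_gradient : forall i p, cdom (atlas M i) p ->
    exists2 u, is_gradient ctfun i p u & past_timelike i p u;
  ctfun_cauchy : forall t, cauchy_hypersurface (ctfun @^-1` [set t]) }.

Section Splitting.
Context {R : realType} {n : nat} {M : spacetime R n} (T : cauchy_temporal M).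

Definition Sigma : set M := T @^-1` [set 0].

(* [alpha] and [h] decompose the metric as - alpha dT (x) dT + h. *)
Definition metric_splits : Prop :=
  exists (alpha : M -> R) (h : cindex M -> M -> 'M[R]_n.+1),
  [/\ forall p, 0 < alpha p /\ smooth_fun_at alpha p,
      symmetric_tensor_field h
    & forall i p, cdom (atlas M i) p ->
      let dT := differential T i p in
      [/\ forall v w, form (metric M i p) v w =
            - alpha p * (dT v * dT w) + form (h i p) v w,
          forall v, v != 0 -> dT v = 0 -> 0 < form (h i p) v v
        & forall u, is_gradient T i p u -> forall v,
            (forall w, form (h i p) v w = 0) <-> exists a, v = a *: u]].

(* [Sigma] is an embedded submanifold of M: a map into it is smooth when it is
   smooth into M, and a map on R * Sigma is smooth when it extends, locally
   around each point, to a smooth map on R * M. *)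
Record splitting := Splitting {
  split :> M -> R * Sigma;
  unsplit : R * Sigma -> M;
  splitK : cancel split unsplit;
  unsplitK : cancel unsplit split;
  split_time : forall p, (split p).1 = T p;
  split_smooth : forall p, smooth_map_at (fun q => set_val (split q).2) p;
  unsplit_smooth : forall z : R * Sigma, exists2 F : R * M -> M,
    smooth_prod_at F (z.1, set_val z.2) &
    \forall y \near z, unsplit y = F (y.1, set_val y.2);
  split_metric : metric_splits }.

End Splitting.

Section Configuration.
Context {R : realType} {n : nat} {M : spacetime R n} {T : cauchy_temporal M}.
Context (Phi : splitting T) (N : nat).

Definition config : topologicalType := (R * {ptws 'I_N -> Sigma T})%type.

Definition particle (j : 'I_N) (p : config) : M := unsplit Phi (p.1, p.2 j).

Definition config_prec (p q : config) : Prop :=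
  forall j, prec (particle j p) (particle j q).

Definition config_sprec (p q : config) : Prop := config_prec p q /\ p <> q.

Definition Gamma : set {compact-open, R -> config} :=
  [set g | causal_curve config_sprec setT g /\ forall t, (g t).1 = t].

End Configuration.

Arguments Gamma {R n M T} Phi N.

Section CurveSpaces.
Context {R : realType} {n : nat} {M : spacetime R n} (T : cauchy_temporal M).

Definition A_curves : set {compact-open, R -> M} :=
  [set g | causal_curve (@sprec _ _ M) setT g /\ forall t, T (g t) = t].

Lemma ctfun_continuous : continuous T.
Proof.
move=> p; have [i ip] := atlas_cover p.
have /nbhs_singleton/(_ [::])[/= cT _] := ctfun_smooth T ip.
have ip' : p \in cdom (atlas M i) by rewrite inE.
have cK : cinv (atlas M i) (atlas M i p) = p by exact: cmapK.
have : (T \o cinv (atlas M i)) \o atlas M i @ p --> T p.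
  by rewrite -[in T p]cK; exact: continuous_comp (cmap_continuous ip') cT.
apply: cvg_trans; apply: near_eq_cvg.
have : nbhs p (cdom (atlas M i)).
  by apply: open_nbhs_nbhs; split => //; exact: cdom_open.
by apply: filterS => q iq /=; rewrite cmapK // inE.
Qed.

Lemma trace_subproof (g : A_curves) : range (set_val g) \in Cinext M.
Proof.
have [cg Tg] := set_valP g; rewrite inE; exists setT, (set_val g); split=> //.
have near_Tp p : nbhs p (T @^-1` ball (T p) 1).
  by apply: ctfun_continuous; exact: nbhsx_ballx.
split=> //; first by exists 0.
- move=> [p /(_ _ (near_Tp p))[t0 _]].
  move=> /(_ (Num.max t0 (T p + 1)) Logic.I); rewrite /ball /= Tg.
  rewrite le_max lexx => /(_ isT).
  have : T p + 1 <= Num.max t0 (T p + 1) by rewrite le_max lexx orbT.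
  by rewrite ltr_norml => ? /andP[? ?]; lra.
- move=> [p /(_ _ (near_Tp p))[t0 _]].
  move=> /(_ (Num.min t0 (T p - 1)) Logic.I); rewrite /ball /= Tg.
  rewrite ge_min lexx => /(_ isT).
  have : Num.min t0 (T p - 1) <= T p - 1 by rewrite ge_min lexx orbT.
  by rewrite ltr_norml => ? /andP[? ?]; lra.
Qed.

Definition trace (g : A_curves) : Cinext M :=
  exist _ (range (set_val g)) (trace_subproof g).

End CurveSpaces.

(* The space of inextendible unparametrised causal curves; [T] is a parameter
   only because the topology is read off from it. *)
Definition Cinext_space (R : realType) (n : nat) (M : spacetime R n)
  (T : cauchy_temporal M) : Type := Cinext M.

Section CinextTopology.
Context {R : realType} {n : nat} {M : spacetime R n} (T : cauchy_temporal M).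

HB.instance Definition _ := Choice.on (Cinext_space T).

(* [trace] being a bijection, its final topology is the transported one. *)
Definition Cinext_open (U : set (Cinext_space T)) : Prop :=
  open (@trace R n M T @^-1` U).

Lemma Cinext_openT : Cinext_open setT.
Proof. by rewrite /Cinext_open preimage_setT; exact: openT. Qed.

Lemma Cinext_openI : setI_closed Cinext_open.
Proof. by move=> U V; exact: openI. Qed.

Lemma Cinext_open_bigU (I : Type) (f : I -> set (Cinext_space T)) :
  (forall i, Cinext_open (f i)) -> Cinext_open (\bigcup_i f i).
Proof. by move=> fo; apply: bigcup_open => i _; exact: fo. Qed.

HB.instance Definition _ := isOpenTopological.Build (Cinext_space T)
  Cinext_openT Cinext_openI Cinext_open_bigU.

End CinextTopology.

(* Main.v *)
(* A configuration curve parametrised by time is an N-tuple of curves of M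
   parametrised by T: the splitting Phi glues and separates the components
   continuously, and evaluation at a time is jointly continuous on the curve
   spaces because R is locally compact.  It remains to see that a curve
   parametrised by T is determined by its image and that every inextendible
   causal curve can be so parametrised.  T increases strictly along causal
   curves, since the product of its past timelike gradient with a future causal
   velocity is positive; as its level sets are Cauchy hypersurfaces, T then maps
   the parameter interval of an inextendible causal curve bijectively onto R,
   and the inverse of this increasing bijection is continuous. *)
From HB Require Import structures.
Require Import Defs.
From mathcomp Require Import all_boot all_order all_algebra.
From mathcomp Require Import all_classical all_reals all_analysis.
From mathcomp Require Import ring lra.

Set Implicit Arguments.
Unset Strict Implicit.
Unset Printing Implicit Defensive.

Import Order.TTheory GRing.Theory Num.Theory.
Import numFieldNormedType.Exports.

Local Open Scope classical_set_scope.
Local Open Scope ring_scope.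

(** * Differentiability from continuous partial derivatives *)

(** The mean value theorem on the segment between 0 and [r], for either sign of [r]. It controls one
    coordinate step in [differentiable_partial]. *)
Lemma sub_linear_le (R : realType) (g : R -> R) (c e r : R) :
  (forall s, `|s| <= `|r| -> derivable g s 1 /\ `|'D_1 g s - c| <= e) ->
  `|g r - g 0 - r * c| <= e * `|r|.
Proof.
move=> gr.
have mvt a b : a <= b -> `|a| <= `|r| -> `|b| <= `|r| ->
    `|g b - g a - (b - a) * c| <= e * (b - a).
  move=> ab ar br.
  have abr s : s \in `[a, b] -> `|s| <= `|r|.
    rewrite in_itv/= => /andP[? ?]; move: ar br; rewrite !ler_norml.
    by move=> /andP[? ?] /andP[? ?]; apply/andP; split; lra.
  have gd s : s \in `]a, b[ -> is_derive s 1 g ('D_1 g s).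
    by move=> sab; apply/derivableP; apply gr; apply/abr/subset_itv_oo_cc.
  have gc : {within `[a, b], continuous g}.
    by apply: derivable_within_continuous => s /abr /gr[].
  have [s /abr/gr[_ sc] ->] := MVT_segment ab gd gc.
  rewrite mulrC -mulrBr normrM (ger0_norm (_ : 0 <= b - a)) ?subr_ge0// mulrC.
  by rewrite ler_wpM2r ?subr_ge0.
have [r0|r0] := leP 0 r.
  by have := mvt 0 r r0; rewrite subr0 normr0 lexx normr_ge0 (ger0_norm r0); apply.
have := mvt r 0 (ltW r0); rewrite sub0r normr0 lexx normr_ge0 (ltr0_norm r0).
move=> /(_ isT isT); congr (_ <= _).
by rewrite -normrN; congr (`|_|); ring.
Qed.

Lemma ler_mx_coord (R : realType) m n (M : 'M[R]_(m, n)) i j : `|M i j| <= `|M|.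
Proof.
rewrite [leRHS]/Num.norm/= mx_normrE.
by apply: (le_bigmax _ (fun ij => `|M ij.1 ij.2|) (i, j)).
Qed.

(** Both difference quotients are the same function of the increment. *)
Lemma derivable_line (R : realType) (V W : normedModType R) (f : V -> W)
    (v z : V) (s : R) :
  derivable f (s *: v + z) v ->
  derivable (fun r : R => f (r *: v + z)) s 1 /\
  'D_1 (fun r : R => f (r *: v + z)) s = 'D_v f (s *: v + z).
Proof.
have E : (fun h : R => h^-1 *: (((fun r : R => f (r *: v + z)) \o shift s) (h *: 1)
       - f (s *: v + z))) =
    (fun h : R => h^-1 *: ((f \o shift (s *: v + z)) (h *: v) - f (s *: v + z))).
  by apply/funext => h /=; rewrite scalerDl [h *: 1]mulr1 addrA.
by rewrite /derivable /derive E.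
Qed.

(** The bound says that the remainder is little-o, and uniqueness then identifies [L] with the
    differential. *)
Lemma differentiable_linear_approx (R : realType) (V W : normedModType R) (f : V -> W)
    (L : {linear V -> W}) (x : V) : continuous L ->
  (forall eps : R, 0 < eps ->
     \forall h \near 0, `|f (h + x) - f x - L h| <= eps * `|h|) ->
  differentiable f x.
Proof.
move=> Lc fL; have E : f \o shift x = cst (f x) + L +o_ 0 id.
  apply/eqaddoP => _/posnumP[eps]; apply: filterS (fL _ (gt0 eps)) => h /=.
  by congr (_ <= _); congr (`|_|); rewrite -addrA -opprD.
by apply/diff_locallyP; rewrite (diff_unique Lc E).
Qed.

Lemma differentiable_partial (R : realType) n (f : 'rV[R]_n -> R) (x : 'rV[R]_n) :
  (forall j, \forall y \near x, derivable f y (delta_mx 0 j)) ->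
  (forall j, {for x, continuous ('D_(delta_mx 0 j) f)}) ->
  differentiable f x.
Proof.
move=> df cf.
pose e j : 'rV[R]_n := delta_mx 0 j.
pose c j := 'D_(e j) f x.
(* [tr k h] keeps the first k coordinates of h; the increment of f along h is
   the telescoping sum of the steps from [tr k h] to [tr k.+1 h]. *)
pose tr k (h : 'rV[R]_n) : 'rV[R]_n := \row_j (if (j < k)%N then h 0 j else 0).
have trS (k : 'I_n) h : tr k.+1 h = h 0 k *: e k + tr k h.
  apply/rowP => j; rewrite !mxE eqxx ltnS leq_eqVlt /=.
  have [->|jk] := eqVneq j k; first by rewrite eqxx ltnn mulr1 addr0.
  by rewrite (inj_eq val_inj) (negPf jk) mulr0 add0r.
have near_step (k : 'I_n) (eps : R) : 0 < eps -> \forall h \near (0 : 'rV[R]_n),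
    `|f (tr k.+1 h + x) - f (tr k h + x) - h 0 k * c k| <= eps * `|h|.
  move=> eps0.
  have : \forall y \near x, derivable f y (e k) /\ `|'D_(e k) f y - c k| <= eps.
    near=> y; split; first by near: y; exact: df.
    by rewrite distrC; near: y; apply: cvgr_dist_le => //; exact: cf.
  move=> /nbhs_ballP[d /= d0 dP].
  apply/nbhs_ballP; exists d => //= h.
  rewrite -ball_normE /= sub0r normrN => hd.
  rewrite trS -(addrA _ (tr k h)).
  (* The norm is the sup norm, and no coordinate of the displacement from [x] exceeds [|h|]. *)
  have near s : `|s| <= `|h 0 k| -> ball x d (s *: e k + (tr k h + x)).
    move=> sh; rewrite -ball_normE /= addrA opprD addrCA subrr addr0 normrN.
    apply: le_lt_trans hd; rewrite [leLHS]/Num.norm/= mx_normrE.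
    apply/bigmax_leP; split => // -[i j] _ /=; rewrite ord1 !mxE eqxx /=.
    have [->|jk]/= := eqVneq j k.
      by rewrite ltnn mulr1 addr0; exact: le_trans sh (ler_mx_coord _ _ _).
    rewrite mulr0 add0r; case: ifP => _; first exact: ler_mx_coord.
    by rewrite normr0.
  have := @sub_linear_le R (fun s => f (s *: e k + (tr k h + x))) (c k) eps (h 0 k).
  rewrite scale0r add0r => H; apply: le_trans (H _) _; last first.
    by rewrite ler_wpM2l ?(ltW eps0) ?ler_mx_coord.
  move=> s /near /dP[? ?].
  by have [? ->] := @derivable_line _ _ _ f (e k) (tr k h + x) s ltac:(by []).
pose L (h : 'rV[R]_n) : R := \sum_j h 0 j * c j.
have Llin : linear L.
  move=> a u v; rewrite /L scaler_sumr -big_split; apply: eq_bigr => j _ /=.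
  by rewrite !mxE mulrDl -mulrA.
pose Ll : {linear 'rV[R]_n -> R} := HB.pack L (GRing.isLinear.Build _ _ _ _ L Llin).
have Lc : continuous L.
  apply: continuous_big => [|j _ h]; first exact: add_continuous.
  exact: (cvgM (@coord_continuous R 1 n 0 j h) (cvg_cst _)).
apply: (@differentiable_linear_approx _ _ _ f Ll x Lc) => eps eps0.
(* There are [n] steps; dividing [eps] by [n + 1] also covers [n = 0]. *)
have n0 : 0 < n%:R + 1 :> R by rewrite ltr_wpDl.
have : \forall h \near (0 : 'rV[R]_n), forall k : 'I_n,
    `|f (tr k.+1 h + x) - f (tr k h + x) - h 0 k * c k| <= eps / (n%:R + 1) * `|h|.
  apply: (@filter_forall _ 'I_n _ (nbhs (0 : 'rV[R]_n))) => k.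
  by apply: near_step; exact: divr_gt0.
apply: filterS => h hP /=.
have tr0 : tr 0 h = 0 by apply/rowP => j; rewrite !mxE.
have trn : tr n h = h by apply/rowP => j; rewrite !mxE ltn_ord.
have -> : f (h + x) - f x - Ll h =
    \sum_(k < n) (f (tr k.+1 h + x) - f (tr k h + x) - h 0 k * c k).
  rewrite sumrB -(big_mkord xpredT (fun k => f (tr k.+1 h + x) - f (tr k h + x))).
  by rewrite telescope_sumr // tr0 trn add0r.
apply: (le_trans (ler_norm_sum _ _ _)).
apply: (le_trans (ler_sum _ (fun k _ => hP k))).
rewrite sumr_const card_ord -(mulr_natr (_ * `|h|)) mulrAC ler_wpM2r //.
rewrite -mulrA ler_piMr ?(ltW eps0) // mulrC ler_pdivrMr // mul1r; lra.
Unshelve. all: by end_near. Qed.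

(** [smooth_at] speaks only of iterated directional derivatives, while the chain rule along a curve
    needs the full differential. *)
Lemma smooth_at_differentiable (R : realType) n (f : 'rV[R]_n -> R) (x : 'rV[R]_n) :
  smooth_at f x -> differentiable f x.
Proof.
move=> fx; apply: differentiable_partial => j.
  by apply: filterS fx => y /(_ [::])[_]; exact.
by have /(_ [:: delta_mx 0 j])[] := nbhs_singleton fx.
Qed.

(** * Signs of Lorentzian products *)

Definition mink_dot (R : realType) (n : nat) (v w : 'rV[R]_n.+1) : R :=
  - (v 0 ord0 * w 0 ord0) + \sum_(i < n) v 0 (lift ord0 i) * w 0 (lift ord0 i).

Lemma form_minkowski (R : realType) (n : nat) (v w : 'rV[R]_n.+1) :
  Defs.form (minkowski_mx R n) v w = mink_dot v w.
Proof.
rewrite /Defs.form /minkowski_mx mxE big_ord_recl /mink_dot.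
rewrite mul_mx_diag !mxE eqxx mulrN1 mulNr; congr (_ + _).
by apply: eq_bigr => i _; rewrite !mxE mulr1.
Qed.

(* In place of Cauchy-Schwarz: the sum over the spatial indices of
   [(v_i w_0 + s w_i v_0)^2 >= 0] with [s = 1, -1] bounds the spatial product
   by [|v_0 w_0|]. *)
Lemma mink_dot_sign (R : realType) (n : nat) (v w : 'rV[R]_n.+1) :
  mink_dot v v < 0 -> mink_dot w w <= 0 -> w 0 ord0 != 0 ->
  (0 < mink_dot v w) = (v 0 ord0 * w 0 ord0 < 0) /\
  (mink_dot v w < 0) = (0 < v 0 ord0 * w 0 ord0).
Proof.
rewrite /mink_dot; move: (v 0 ord0) (w 0 ord0) => v0 w0.
pose a (i : 'I_n) := v 0 (lift ord0 i); pose b (i : 'I_n) := w 0 (lift ord0 i).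
rewrite -/(a _) -/(b _).
set A := \sum_(i < n) _; set B := \sum_(i < n) _; set C := \sum_(i < n) _.
move=> vv ww w00.
have sq s : 0 <= A * w0 ^+ 2 + 2 * s * (v0 * w0) * C + (s * v0) ^+ 2 * B.
  rewrite /A /B /C mulr_suml !mulr_sumr -!big_split /=; apply: sumr_ge0 => i _.
  have -> : v 0 (lift ord0 i) * v 0 (lift ord0 i) * w0 ^+ 2 +
      2 * s * (v0 * w0) * (v 0 (lift ord0 i) * w 0 (lift ord0 i)) +
      (s * v0) ^+ 2 * (w 0 (lift ord0 i) * w 0 (lift ord0 i)) =
      (v 0 (lift ord0 i) * w0 + s * v0 * w 0 (lift ord0 i)) ^+ 2 by ring.
  exact: sqr_ge0.
have w2 : 0 < w0 ^+ 2 by rewrite exprn_even_gt0.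
have v2 : 0 <= v0 ^+ 2 by exact: sqr_ge0.
have hA : A * w0 ^+ 2 < v0 ^+ 2 * w0 ^+ 2 by rewrite ltr_pM2r // expr2; lra.
have hB : v0 ^+ 2 * B <= v0 ^+ 2 * w0 ^+ 2 by rewrite ler_wpM2l // expr2; lra.
have s1 := sq 1; have s2 := sq (-1).
have p0 : v0 * w0 != 0.
  rewrite mulf_neq0 //; apply/eqP => v00; move: vv; rewrite v00.
  have : 0 <= A by apply: sumr_ge0 => i _; rewrite -expr2 sqr_ge0.
  by lra.
have E : v0 ^+ 2 * w0 ^+ 2 = (v0 * w0) ^+ 2 by rewrite exprMn.
have H1 : 0 < 2 * (v0 * w0) * C + 2 * (v0 * w0) ^+ 2 by lra.
have H2 : 0 < - (2 * (v0 * w0) * C) + 2 * (v0 * w0) ^+ 2 by lra.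
(* [H2] says that [p * C < p ^+ 2], so [C - p], which is the Minkowski product, has the sign
   opposite to that of [p]. *)
move: p0 H1 H2; move: (v0 * w0) => p; rewrite neq_lt => /orP[p0|p0] H1 H2.
  have ? : p < C by rewrite -(ltr_nM2l p0); lra.
  by split; apply/idP/idP => ?; lra.
have ? : C < p by rewrite -(ltr_pM2l p0); lra.
by split; apply/idP/idP => ?; lra.
Qed.

(** In a basis where [G] is Minkowski, the product of a timelike and a causal vector has the sign
    opposite to that of the product of their time components. These have opposite signs for [x] and
    [u] and equal signs for [x] and [v], hence opposite signs for [u] and [v]. *)
Lemma lorentzian_past_future (R : realType) (n : nat) (G : 'M[R]_n.+1)
    (x u v : 'rV[R]_n.+1) : lorentzian G ->
  Defs.form G x x < 0 -> Defs.form G u u < 0 -> 0 < Defs.form G x u ->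
  Defs.form G v v <= 0 -> Defs.form G x v < 0 -> 0 < Defs.form G u v.
Proof.
case=> P Pu PG.
have formE y z : Defs.form G y z = mink_dot (y *m invmx P) (z *m invmx P).
  rewrite -form_minkowski -PG /Defs.form trmx_mul trmx_inv !mulmxA mulmxKV //.
  by rewrite mulmxK // unitmx_tr.
rewrite !formE; move: (x *m _) (u *m _) (v *m _) => {}x {}u {}v.
have nz y : mink_dot y y < 0 -> y 0 ord0 != 0.
  apply: contraTneq => y0; rewrite /mink_dot y0 mulr0 oppr0 add0r -leNgt.
  by apply: sumr_ge0 => i _; rewrite -expr2 sqr_ge0.
move=> xx uu xu vv xv.
(* Otherwise causality would make every spatial component vanish as well, and [v] would be
   orthogonal to [x]. *)
have v0 : v 0 ord0 != 0.
  apply: contraTneq xv => v0; move: vv; rewrite /mink_dot v0 !mulr0 oppr0 !add0r => vv.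
  have vi i : v 0 (lift ord0 i) = 0.
    have : v 0 (lift ord0 i) * v 0 (lift ord0 i) <= 0.
      apply: le_trans vv; rewrite (bigD1 i) //= lerDl.
      by apply: sumr_ge0 => k _; rewrite -expr2 sqr_ge0.
    by rewrite -expr2 => H; apply/eqP; rewrite -sqrf_eq0 eq_le H sqr_ge0.
  by rewrite big1 ?ltxx // => i _; rewrite vi mulr0.
have [xuE _] := mink_dot_sign xx (ltW uu) (nz _ _ _ uu).
have [_ xvE] := mink_dot_sign xx vv v0.
have [uvE _] := mink_dot_sign uu vv v0.
move: xu xv; rewrite xuE xvE uvE.
have : x 0 ord0 * u 0 ord0 < 0 -> 0 < x 0 ord0 * v 0 ord0 ->
  (x 0 ord0) ^+ 2 * (u 0 ord0 * v 0 ord0) < 0.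
  move=> h1 h2; have -> : x 0 ord0 ^+ 2 * (u 0 ord0 * v 0 ord0) =
    (x 0 ord0 * u 0 ord0) * (x 0 ord0 * v 0 ord0) by ring.
  by rewrite nmulr_rlt0.
move=> H h1 h2; move: (H h1 h2).
by rewrite pmulr_rlt0 // exprn_even_gt0 //= nz.
Qed.

(** * The time function along causal curves *)

Section TimeFunction.
Context {R : realType} {n : nat} {M : spacetime R n} (T : cauchy_temporal M).

(** In a chart, the chain rule gives the derivative as the differential of [T] on the velocity, i.e.
    the metric product of the past timelike gradient with a future causal vector. *)
Lemma time_smooth_causal (c : R -> M) (t : R) : smooth_causal_at c t ->
  derivable (T \o c) t 1 /\ 0 < derive1 (T \o c) t.
Proof.
move=> [[cc sc] causal]; have [i ip] := atlas_cover (c t).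
set A := atlas M i; pose k := A \o c; pose f := T \o cinv A.
have ip' : c t \in cdom A by rewrite inE.
have dk : differentiable (k : R -> 'rV[R]_n.+1) t.
  apply/derivable1_diffP.
  by have /(_ [::])[_ /(_ 1)] := nbhs_singleton (sc i ip).
have df : differentiable f (k t).
  exact/smooth_at_differentiable/(ctfun_smooth T).
(* [cinv] inverts the chart only on its domain, so the two functions agree just near [t], which
   suffices for derivatives. *)
have Tc : \forall s \near t, f (k s) = T (c s).
  have : \forall s \near t, cdom A (c s).
    by apply: cc; apply: open_nbhs_nbhs; split => //; exact: cdom_open.
  by apply: filterS => s As; rewrite /f /k /= cmapK // inE.
have dfk : differentiable (f \o k) t by exact: differentiable_comp.
have E : derive1 (T \o c) t = 'D_(velocity c i t) f (k t).
  rewrite derive1E -(near_eq_derive _ Tc) deriveE // diff_comp //.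
  by rewrite /= [RHS]deriveE // /velocity derive1E' .
split; first by apply: (near_eq_derivable Tc); exact/derivable1_diffP.
have [u ug [uu xu]] := ctfun_gradient T ip.
have [_ vv xv] := causal i ip.
rewrite E -/(differential T i (c t) _) -ug.
exact: lorentzian_past_future (metric_lorentzian ip) (torient_timelike ip) uu xu vv xv.
Qed.

(** Induction on the partition: on each closed piece [g] coincides with a smooth causal curve, along
    which [T] has positive derivative. *)
Lemma time_pw_smooth_causal (g : R -> M) (a b : R) :
  pw_smooth_causal g a b -> T (g a) < T (g b).
Proof.
move=> [ab _ [s [sp /eqP sl] sc]].
have {ab}: s != [::] by apply: contraTneq ab => s0; rewrite -sl s0 /= ltxx.
elim: s a sp sl sc => // x s IH a /= /andP[ax sp] sl sc _.
have Tax : T (g a) < T (g x).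
  have [c cJ] := sc 0%N isT; rewrite /= in cJ.
  have [-> _] := cJ a ltac:(by rewrite /= in_itv /= lexx ltW).
  have [-> _] := cJ x ltac:(by rewrite /= in_itv /= lexx ltW).
  have dT t : t \in `[a, x] -> derivable (T \o c) t 1 /\ 0 < derive1 (T \o c) t.
    by move=> tax; apply: time_smooth_causal; have [] := cJ t tax.
  apply: (@gtr0_derive1_lt_cc _ (T \o c) a x) => //.
  - by move=> t /subset_itv_oo_cc /dT[].
  - by move=> t /subset_itv_oo_cc /dT[].
  - by apply: derivable_within_continuous => t /dT[].
  - by rewrite in_itv /= lexx ltW.
  - by rewrite in_itv /= lexx ltW.
case: s => [|y s] in IH sp sl sc *; first by rewrite -sl.
apply: (lt_trans Tax); apply: IH => // k ks.
by have := sc k.+1 ks.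
Qed.

Lemma time_sprec (p q : M) : sprec p q -> T p < T q.
Proof.
by move=> [[//|[g [a [b [pg <- <-]]]]] _]; exact: time_pw_smooth_causal.
Qed.

End TimeFunction.

(** * Time-parametrised curves and their images *)

Section CurveTraces.
Context {R : realType} {n : nat} {M : spacetime R n} (T : cauchy_temporal M).

Lemma A_curve_time (g : A_curves T) (t : R) : T (set_val g t) = t.
Proof. by have [_] := set_valP g; apply. Qed.

Lemma A_curve_continuous (g : A_curves T) : continuous (set_val g : R -> M).
Proof. by have [[gc _] _] := set_valP g; exact/continuous_subspace_setT. Qed.

Lemma A_curve_prec (g : A_curves T) (s t : R) : s < t ->
  prec (set_val g s) (set_val g t).
Proof. by have [[_ gc] _] := set_valP g => /(gc s t Logic.I Logic.I)[]. Qed.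

Lemma A_curve_eqP (g h : A_curves T) :
  (forall t, set_val g t = set_val h t) -> g = h.
Proof. by move=> gh; apply: val_inj; apply/funext. Qed.

(** [prec] suffices: equal points have equal times, so strictness comes from [T \o g] being the
    identity. *)
Lemma mem_A_curves (g : R -> M) : continuous g ->
  (forall s t, s < t -> prec (g s) (g t)) -> (forall t, T (g t) = t) ->
  g \in A_curves T.
Proof.
move=> gc gp gT; rewrite inE; split => //; split; first exact: continuous_subspaceT.
move=> s t _ _ st; split; first exact: gp.
by move=> /(congr1 T); rewrite !gT => E; rewrite E ltxx in st.
Qed.

(** Each point of a curve sits at the parameter given by its own [T]-value, so the image determines
    the curve. *)
Lemma trace_inj : injective (@Defs.trace _ _ _ T).
Proof.
move=> g h [E]; apply: A_curve_eqP => t.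
have [s _ hs] : range (set_val h) (set_val g t) by rewrite -E; exists t.
by rewrite -hs; congr (set_val h _); rewrite -(A_curve_time g t) -hs A_curve_time.
Qed.

(* The inverse of the increasing bijection [T \o g : I -> R] reparametrises
   the curve. *)
Lemma trace_surj (L : Cinext M) : exists g : A_curves T, Defs.trace g = L.
Proof.
case: L => L LP; have := LP; rewrite inE => -[I [g [gI gL]]].
have [Iint _ [gc glt] _ _] := gI.
(* The level set of [T] at [t] is a Cauchy hypersurface, so the curve meets it; [cid] picks the
   parameter. *)
have tauP t : {s | I s /\ T (g s) = t}.
  by apply: cid; have [s [sP _]] := @ctfun_cauchy _ _ _ T t I g gI; exists s.
pose tau t := sval (tauP t).
have Itau t : I (tau t) by rewrite /tau; case: (tauP t) => s [].
have Ttau t : T (g (tau t)) = t by rewrite /tau; case: (tauP t) => s [].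
have Tlt s s' : I s -> I s' -> s < s' -> T (g s) < T (g s').
  by move=> Is Is' ss'; apply: time_sprec; exact: glt.
have Tle s s' : I s -> I s' -> T (g s) < T (g s') -> s < s'.
  move=> Is Is'; apply: contraTT; rewrite -!leNgt le_eqVlt => /orP[/eqP->//|].
  by move=> /(Tlt _ _ Is' Is)/ltW.
have taulty s t : s < t -> tau s < tau t by move=> st; apply: Tle; rewrite ?Ttau.
have tauc : continuous tau.
  move=> t; apply/cvgrPdist_lt => e e0.
  (* Both bounds stay within [e / 2] of [tau t]; clipping by [tau (t - 1)] and [tau (t + 1)] keeps
     them in the interval [I], where [T \o g] is known to increase. *)
  pose a := Num.max (tau t - e / 2) (tau (t - 1)).
  pose b := Num.min (tau t + e / 2) (tau (t + 1)).
  have t1 : tau (t - 1) < tau t by apply: taulty; lra.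
  have t2 : tau t < tau (t + 1) by apply: taulty; lra.
  have at_ : a < tau t by rewrite gt_max t1 andbT; lra.
  have tb : tau t < b by rewrite lt_min t2 andbT; lra.
  have Ia : I a.
    by apply: (Iint _ _ (Itau (t - 1)) (Itau t)); rewrite le_max lexx orbT ltW.
  have Ib : I b.
    by apply: (Iint _ _ (Itau t) (Itau (t + 1))); rewrite ge_min lexx orbT ltW.
  have ae : tau t - e / 2 <= a by rewrite le_max lexx.
  have be : b <= tau t + e / 2 by rewrite ge_min lexx.
  (* Monotonicity turns the window around [tau t] into one around [t]. *)
  have : T (g a) < t < T (g b) by rewrite -(Ttau t) !Tlt ?Ttau.
  move=> /andP[h1 h2]; near=> s.
  have as_ : a < tau s.
    by apply: Tle => //; rewrite Ttau; near: s; exact: lt_nbhsr.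
  have sb : tau s < b.
    by apply: Tle => //; rewrite Ttau; near: s; exact: lt_nbhsl.
  rewrite ltr_norml; apply/andP; split; lra.
have gtc : continuous (g \o tau).
  (* [g] is continuous only within [I], but [tau] never leaves [I]. *)
  move=> t; have /subspace_continuousP/(_ _ (Itau t)) := gc.
  apply: cvg_trans => U IU.
  by apply: (@filterS _ (nbhs t) _ _ _ _ (tauc t _ IU)) => s /(_ (Itau s)).
have gtA : g \o tau \in A_curves T.
  by apply: mem_A_curves => // s t /taulty/(glt _ _ (Itau s) (Itau t))[].
exists (SigSub gtA); apply: val_inj => /=; rewrite -gL eqEsubset; split.
  by move=> _ [t _ <-]; exists (tau t).
move=> _ [s Is <-]; exists (T (g s)) => //; change (g (tau (T (g s))) = g s).
(* The parameters [s] and [tau (T (g s))] have the same time, so strict monotonicity forces them to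
   be equal. *)
have [lt|lt|->//] := ltgtP (tau (T (g s))) s.
  by have := Tlt _ _ (Itau _) Is lt; rewrite Ttau ltxx.
by have := Tlt _ _ Is (Itau _) lt; rewrite Ttau ltxx.
Unshelve. all: by end_near. Qed.

Definition trace_inv (L : Cinext_space T) : A_curves T := sval (cid (trace_surj L)).

Lemma trace_invK : cancel trace_inv (@Defs.trace _ _ _ T).
Proof. by move=> L; rewrite /trace_inv; case: cid. Qed.

Lemma traceK : cancel (@Defs.trace _ _ _ T) trace_inv.
Proof. by move=> g; apply: trace_inj; rewrite trace_invK. Qed.

Lemma trace_continuous :
  continuous (@Defs.trace _ _ _ T : A_curves T -> Cinext_space T).
Proof. by apply/continuousP. Qed.

(** Open sets of [Cinext_space T] are those with open preimage under [trace], and pulling [U] back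
    along [trace_inv] and then [trace] returns [U]. *)
Lemma trace_inv_continuous : continuous trace_inv.
Proof.
apply/continuousP => U oU; change (open (@Defs.trace _ _ _ T @^-1` (trace_inv @^-1` U))).
rewrite (_ : _ @^-1` _ = U) //; apply/seteqP.
by split=> g /=; rewrite traceK.
Qed.

End CurveTraces.

(** * Continuity in product and compact-open topologies *)

Lemma continuous_ptws (X : topologicalType) (I : Type) (Y : topologicalType)
    (f : X -> {ptws I -> Y}) :
  (forall i, continuous (fun x => f x i)) -> continuous f.
Proof.
move=> fc x; apply/cvg_sup => i U [B [[V oV <-] Vfx]] /filterS; apply.
by apply: fc; exact: open_nbhs_nbhs.
Qed.

(** The maps [g] for which [h \o g] sends [K] into [O] are those sending [K] into the preimage of
    [O] under [h], again a subbasic open set. *)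
Lemma compact_open_comp_continuous (X Y Z : topologicalType) (h : Y -> Z) :
  continuous h ->
  continuous ((fun g => h \o g) : {compact-open, X -> Y} -> {compact-open, X -> Z}).
Proof.
move=> hc g.
apply/compact_open_cvgP.
  exact: fmap_filter (nbhs_filter (g : {compact-open, X -> Y})).
move=> K O cK oO hgO.
have : nbhs (g : {compact-open, X -> Y}) [set f | f @` K `<=` h @^-1` O].
  apply: open_nbhs_nbhs; split.
    by apply: compact_open_open => //; move/continuousP : hc; apply.
  by move=> _ [x Kx <-]; apply: hgO; exists x.
by apply: filterS => f fK _ [x Kx <-]; apply: fK; exists x.
Qed.

Lemma continuous_set_type (X Y : topologicalType) (A : set Y) (f : X -> A) :
  continuous (set_val \o f : X -> Y) -> continuous f.
Proof. exact: continuous_comp_initial. Qed.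

Lemma continuousT_comp (X Y Z : topologicalType) (f : X -> Y) (g : Y -> Z) :
  continuous f -> continuous g -> continuous (g \o f).
Proof. by move=> fc gc x; apply: continuous_comp; [exact: fc|exact: gc]. Qed.

Lemma continuous_pair (X Y Z : topologicalType) (f : X -> Y) (g : X -> Z) :
  continuous f -> continuous g -> continuous (fun x => (f x, g x)).
Proof. by move=> fc gc x; exact: cvg_pair (fc x) (gc x). Qed.

Lemma continuous_fst (X Y : topologicalType) : continuous (@fst X Y).
Proof. by move=> z; exact: cvg_fst. Qed.

Lemma continuous_snd (X Y : topologicalType) : continuous (@snd X Y).
Proof. by move=> z; exact: cvg_snd. Qed.

Lemma continuous_ptws_eval (X Y : topologicalType) (I : eqType) (i : I)
    (f : X -> {ptws I -> Y}) :
  continuous f -> continuous (fun x => f x i).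
Proof.
by move=> fc; exact: continuousT_comp fc (@proj_continuous I (fun=> Y) i).
Qed.

(** * Configuration curves and tuples of particle curves *)

Section Configurations.
Context {R : realType} {n : nat} {M : spacetime R n} {T : cauchy_temporal M}.
Context (Phi : splitting T) (N : nat).
Local Notation config_space := (@config R n M T N).

Lemma continuous_split2 : continuous (fun p : M => (Phi p).2).
Proof.
apply: (@continuous_set_type _ _ (Sigma T)) => p.
by have [] := split_smooth Phi p.
Qed.

(** Near [z], [unsplit] is the restriction to [R * Sigma] of a map continuous at the image of
    [z]. *)
Lemma continuous_unsplit : continuous (Defs.unsplit Phi).
Proof.
move=> z; have [F [cF _] nF] := unsplit_smooth Phi z.
have vc : continuous (fun y : R * Sigma T => (y.1, set_val y.2)).
  apply: continuous_pair; first exact: continuous_fst.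
  by apply: (continuousT_comp (@continuous_snd _ _)); exact: initial_continuous.
have cv := continuous_comp (vc z) cF.
rewrite /continuous_at (nbhs_singleton nF); apply: cvg_trans cv.
by apply: near_eq_cvg; apply: filterS nF => y ->.
Qed.

Lemma unsplit_time z : T (Defs.unsplit Phi z) = z.1.
Proof. by rewrite -(split_time Phi) Defs.unsplitK. Qed.

Lemma splitE p : Phi p = (T p, (Phi p).2).
Proof. by rewrite -(split_time Phi) -surjective_pairing. Qed.

Lemma continuous_particle j : continuous (@particle _ _ _ _ Phi N j).
Proof.
have pc : continuous (fun p : config_space => (p.1, p.2 j)).
  apply: continuous_pair; first exact: continuous_fst.
  exact: continuous_ptws_eval (@continuous_snd _ _).
exact: continuousT_comp pc continuous_unsplit.
Qed.

Lemma Gamma_time (g : Defs.Gamma Phi N) t : (set_val g t).1 = t.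
Proof. by have [_] := set_valP g; apply. Qed.

Lemma Gamma_continuous (g : Defs.Gamma Phi N) :
  continuous (set_val g : R -> config_space).
Proof. by have [[gc _] _] := set_valP g; exact/continuous_subspace_setT. Qed.

Lemma particle_mem (g : Defs.Gamma Phi N) j :
  (particle Phi j \o set_val g) \in A_curves T.
Proof.
apply: mem_A_curves => [t|s t st|t].
- by apply: continuous_comp; [exact: Gamma_continuous|exact: continuous_particle].
- by have [[_ gp] _] := set_valP g; have [+ _] := gp s t Logic.I Logic.I st; apply.
- by rewrite unsplit_time Gamma_time.
Qed.

Definition particle_curve (g : Defs.Gamma Phi N) j : A_curves T :=
  SigSub (particle_mem g j).

Lemma continuous_particle_curve j : continuous (particle_curve ^~ j).
Proof.
apply: (@continuous_set_type _ _ (A_curves T)) => g.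
apply: (@continuous_comp _ _ _ (@set_val _ (Defs.Gamma Phi N))
  ((fun f => particle Phi j \o f) :
     {compact-open, R -> config_space} -> {compact-open, R -> M})).
  exact: initial_continuous.
by apply: compact_open_comp_continuous; exact: continuous_particle.
Qed.

Definition assemble_fun (c : 'I_N -> A_curves T) (t : R) : config_space :=
  (t, fun j => (Phi (set_val (c j) t)).2).

Lemma particle_assemble c j t : particle Phi j (assemble_fun c t) = set_val (c j) t.
Proof. by rewrite /particle /= -[RHS](Defs.splitK Phi) [in RHS]splitE A_curve_time. Qed.

Lemma A_curve_eval_continuous :
  continuous (uncurry (@set_val _ (A_curves T) : A_curves T -> R -> M)).
Proof.
apply: continuous_uncurry_regular.
- exact: locally_compactR.
- exact: uniform_regular.
- exact: initial_continuous.
- exact: A_curve_continuous.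
Qed.

(** Joint continuity in the tuple and the time is what currying needs: it yields both the continuity
    of each assembled curve and that of [assemble]. *)
Lemma assemble_fun_continuous :
  continuous (uncurry (assemble_fun : {ptws 'I_N -> A_curves T} -> R -> config_space)).
Proof.
have cj j : continuous
    (fun z : {ptws 'I_N -> A_curves T} * R => (Phi (set_val (z.1 j) z.2)).2).
  have c1 : continuous (fun z : {ptws 'I_N -> A_curves T} * R => (z.1 j, z.2)).
    apply: continuous_pair; last exact: continuous_snd.
    exact: continuous_ptws_eval (@continuous_fst _ _).
  exact: continuousT_comp (continuousT_comp c1 A_curve_eval_continuous) continuous_split2.
rewrite (_ : uncurry _ = fun z => (z.2, fun j => (Phi (set_val (z.1 j) z.2)).2));
  last by apply/funext => -[].
by apply: continuous_pair; [exact: continuous_snd|exact: continuous_ptws].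
Qed.

Lemma assemble_fun_mem (c : {ptws 'I_N -> A_curves T}) :
  assemble_fun c \in Defs.Gamma Phi N.
Proof.
have [_ cc] := continuous_curry assemble_fun_continuous.
rewrite inE; split => //; split; first by apply: continuous_subspaceT; exact: cc.
(* The configurations differ because their first components are the distinct times [s] and [t]. *)
move=> s t _ _ st; split; last by move=> [E _]; rewrite E ltxx in st.
by move=> j; rewrite !particle_assemble; exact: A_curve_prec.
Qed.

Definition assemble (c : {ptws 'I_N -> A_curves T}) : Defs.Gamma Phi N :=
  SigSub (assemble_fun_mem c).

Lemma continuous_assemble : continuous assemble.
Proof.
apply: (@continuous_set_type _ _ (Defs.Gamma Phi N)).
exact: continuous_curry_fun assemble_fun_continuous.
Qed.

Lemma particle_curveK : cancel particle_curve assemble.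
Proof.
move=> g; apply: val_inj; apply/funext => t.
change (assemble_fun (particle_curve g) t = set_val g t).
rewrite [RHS]surjective_pairing Gamma_time; congr pair; apply/funext => j.
change ((Phi (Defs.unsplit Phi ((set_val g t).1, (set_val g t).2 j))).2 =
  (set_val g t).2 j).
by rewrite Defs.unsplitK.
Qed.

Lemma assembleK : cancel assemble particle_curve.
Proof.
move=> c; apply/funext => j; apply: A_curve_eqP => t; exact: particle_assemble.
Qed.

End Configurations.

(** A composite of two homeomorphisms through the [N]-tuples of [A_curves T]: [particle_curve] with
    inverse [assemble], then [trace] in each factor. *)
Theorem corollary21 (R : realType) (n : nat) (M : spacetime R n)
    (hM : globally_hyperbolic M) (T : cauchy_temporal M) (Phi : splitting T)
    (N : nat) (hN : (0 < N)%N) :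
  homeomorphic (Gamma Phi N) {ptws 'I_N -> Cinext_space T}.
Proof.
exists (fun g j => Defs.trace (particle_curve g j)).
exists (fun c => assemble Phi (fun j => trace_inv (c j))).
split.
- apply: continuous_ptws => j.
  exact: continuousT_comp (@continuous_particle_curve _ _ _ _ Phi N j)
    (@trace_continuous _ _ _ _).
- have cinv : continuous (fun c : {ptws 'I_N -> Cinext_space T} =>
      (fun j => trace_inv (c j)) : {ptws 'I_N -> A_curves T}).
    apply: continuous_ptws => j.
    have cj : continuous (fun c : {ptws 'I_N -> Cinext_space T} => c j).
      exact: (@proj_continuous 'I_N (fun=> Cinext_space T)).
    exact: continuousT_comp cj (@trace_inv_continuous _ _ _ _).
  exact: continuousT_comp cinv (@continuous_assemble _ _ _ _ _ _).
- move=> g /=; rewrite -[RHS]particle_curveK; congr assemble.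
  by apply/funext => j; rewrite traceK.
- by move=> c; apply/funext => j; rewrite assembleK trace_invK.
Qed.
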